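(* Let $a>1$ be an integer, let $p$ be a prime with $p > 11+4\sqrt{7}$, let $K \ge 1$ be an integer, and let $N = 2Kp^3+1$. Suppose that $2K < \log_a(2Kp^3+1)$, that $2K < \sqrt{p}$, and that $2K$ is not a perfect cube. If $a^{N-1} \equiv 1 \pmod N$, then $N$ is prime. *)

(* Defs.v *)
(* MathComp / MathComp-Analysis; R ranges over models of the real numbers. *)
From HB Require Import structures.
From mathcomp Require Import all_boot all_order all_algebra.
From mathcomp Require Import reals exp.
Set Implicit Arguments.
Unset Strict Implicit.
Unset Printing Implicit Defensive.
Import Order.TTheory GRing.Theory Num.Theory.
Local Open Scope ring_scope.

(* Meaningful for 0 < b, b != 1 and 0 < x; ln is a total function. *)
Definition log_base (R : realType) (b x : R) : R := ln x / ln b.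

Definition perfect_cube (n : nat) : Prop := exists c : nat, n = (c ^ 3)%N.

(* Main.v *)
(** By Fermat's congruence a^(2Kp^3) = 1, while 1 < a^(2K) < N, so p divides
    the totient of N; since p does not divide N, some prime q = 1 (mod p)
    divides N.  If N is not prime then N = (1 + up)(1 + vp) with 1 <= v <= u.
    Comparing coefficients, u + v = sp and uv + s = 2Kp, so that
    p(2K - vs) = s - v^2.  Either both sides vanish, and 2K = v^3 is a cube, or
    size considerations force s = 1, whence p divides (v - 1)(v + 1), which is
    absurd because 1 < v < p - 1. *)
Require Import Defs.
From HB Require Import structures.
From mathcomp Require Import all_boot all_order all_algebra.
From mathcomp Require Import reals exp.
From mathcomp Require Import cyclic zify.
Set Implicit Arguments.
Unset Strict Implicit.
Unset Printing Implicit Defensive.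
Import Order.TTheory GRing.Theory Num.Theory.
Local Open Scope ring_scope.

(** The totient is a product of factors (q - 1) q^(e - 1) over the primes q dividing n; p could
    divide q^(e - 1) only if p = q, which [~~ (p %| n)] excludes. *)
Lemma prime_dvd_totient p n : prime p -> (p %| totient n)%N -> ~~ (p %| n)%N ->
  exists2 q, prime q & (q %| n)%N && (p %| q.-1)%N.
Proof.
move=> p_pr p_tot p'n.
have n_gt0 : (0 < n)%N by case: n p'n {p_tot} => //; rewrite dvdn0.
move: p_tot; rewrite totientE // Euclid_dvd_prod // big_has => /hasP[q].
rewrite mem_primes => /and3P[q_pr _ q_dvd].
rewrite Euclid_dvdM // Euclid_dvdX // => /orP[p_q | /andP[p_q _]].
  by exists q; rewrite ?q_dvd.
by case/negP: p'n; apply: dvdn_trans q_dvd.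
Qed.

(** Bezout gives k with k m = 1 modulo the totient, so b = b^(k m) = 1 by Euler. *)
Lemma expn_eq1_mod_coprime b m n : coprime b n -> (0 < m)%N ->
  coprime m (totient n) -> (b ^ m = 1 %[mod n])%N -> (b = 1 %[mod n])%N.
Proof.
move=> cbn m_gt0 cmt bm1.
case: (egcdnP (totient n) m_gt0) => k l; rewrite (eqP cmt) => kmE _.
have : (b ^ (k * m) = 1 %[mod n])%N.
  by rewrite mulnC expnM -modnXm bm1 modnXm exp1n.
rewrite kmE expnD expn1 -modnMml mulnC [in X in X -> _]mulnC (mulnC l) expnM.
by rewrite -modnXm Euler_exp_totient // modnXm exp1n modnMml mul1n.
Qed.

Lemma modn1_factorization p h m n : prime p -> (11 < p)%N -> (0 < h)%N ->
    (h ^ 2 < p)%N -> ~ perfect_cube h -> (0 < n)%N -> (n <= m)%N ->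
  (h * p ^ 3 + 1 = (m * p + 1) * (n * p + 1))%N -> False.
Proof.
move=> p_pr p_gt h_gt0 hp hcube n_gt0 n_le E.
have p_gt0 : (0 < p)%N by lia.
have E1 : (h * p ^ 2 = m * n * p + (m + n))%N.
  by apply/eqP; rewrite -(eqn_pmul2r p_gt0); apply/eqP; lia.
have /dvdnP[s sE] : (p %| m + n)%N.
  by rewrite -(dvdn_addr (m + n) (dvdn_mull (m * n) (dvdnn p))) -E1 dvdn_mull ?dvdn_exp.
have E2 : (h * p = m * n + s)%N.
  by apply/eqP; rewrite -(eqn_pmul2r p_gt0); apply/eqP; lia.
(* This is p(h - n s) = s - n^2 without subtraction: multiply m + n = s p by n and eliminate m n
   through [E2]. *)
have E3 : (h * p + n ^ 2 = n * s * p + s)%N.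
  have : (n * (m + n) = n * (s * p))%N by rewrite sE.
  by lia.
have s_gt0 : (0 < s)%N by case: s sE {E2 E3} => //; lia.
have n2_le : (n ^ 2 <= m * n)%N by rewrite leq_mul.
(* n s p = m n + n^2 <= 2 m n < 2 h p. *)
have ns_lt : (n * s < 2 * h)%N by rewrite -(ltn_pmul2r p_gt0); lia.
have s_le : (s <= h)%N.
  (* This is (m - 1)(n - 1) >= 0; hence s p = m + n <= m n + s = h p. *)
  have mn_le : (m + n <= m * n + 1)%N by clear -n_gt0 n_le; nia.
  by rewrite -(leq_pmul2r p_gt0); lia.
have h_lt : (2 * h < p)%N by clear -hp p_gt; nia.
have [lt|gt|eq] := ltngtP (n * s) h.
(* Here (n s + 1) p <= h p, so [E3] forces p + n^2 <= s, against s <= h < p. *)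
- have := leq_mul lt (leqnn p); lia.
(* Now (h + 1) p <= n s p, and [E3] yields h^2 < p < n^2. Then n s < 2 h < 2 n leaves only s = 1. *)
- have h_lt_n : (h < n)%N.
    rewrite -ltn_sqr; apply: leq_trans hp _.
    by have := leq_mul gt (leqnn p); lia.
  have s1 : s = 1%N by clear -h_lt_n ns_lt s_gt0; nia.
  rewrite s1 !muln1 in E3 ns_lt.
  have : (p %| (n - 1) * (n + 1))%N.
    apply/dvdnP; exists (n - h)%N; rewrite -subn_sqr mulnBl; lia.
  (* Both factors are positive and less than p, since 1 <= h < n < 2 h < p. *)
  by rewrite Euclid_dvdM // => /orP[] /dvdn_leq; lia.
- rewrite eq in E3; have sn2 : s = (n ^ 2)%N by lia.
  by apply: hcube; exists n; rewrite -eq sn2 -expnS.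
Qed.

Lemma ltn_log_base (R : realType) (a k n : nat) : (1 < a)%N -> (0 < n)%N ->
  (k%:R < log_base a%:R n%:R :> R) = (a ^ k < n)%N.
Proof.
move=> a_gt1 n_gt0.
have a_gt0 : 0 < a%:R :> R by rewrite ltr0n; lia.
rewrite /log_base ltr_pdivlMr ?ln_gt0 ?ltr1n //.
by rewrite mulr_natl -lnXn // ltr_ln ?posrE ?exprn_gt0 // ?ltr0n // -natrX ltr_nat.
Qed.

Lemma ltn_natr_sqrt (R : realType) (k n : nat) :
  (k%:R < Num.sqrt n%:R :> R) = (k ^ 2 < n)%N.
Proof.
rewrite -[k%:R]normr_nat -sqrtr_sqr !ltNge ler_sqrt ?sqr_ge0 //.
by rewrite -natrX ler_nat -ltnNge.
Qed.

Theorem corollary3p5 (R : realType) (a p K N : nat)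
  (ha : (1 < a)%N)
  (hp : prime p)
  (hp_gt : 11 + 4 * Num.sqrt 7 < p%:R :> R)
  (hK : (1 <= K)%N)
  (hN : N = (2 * K * p ^ 3 + 1)%N)
  (hlog : (2 * K)%N%:R < log_base a%:R (2 * K * p ^ 3 + 1)%N%:R :> R)
  (hsqrt : (2 * K)%N%:R < Num.sqrt p%:R :> R)
  (hcube : ~ perfect_cube (2 * K)%N)
  (hfermat : (a ^ (N - 1) = 1 %[mod N])%N) :
  prime N.
Proof.
have p_gt : (11 < p)%N.
  rewrite -(ltr_nat R); apply: le_lt_trans hp_gt.
  by rewrite lerDl mulr_ge0 ?sqrtr_ge0.
move: hlog hsqrt; rewrite -hN ltn_log_base ?ltn_natr_sqrt //; last by lia.
have h_gt0 : (0 < 2 * K)%N by lia.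
move: (2 * K)%N h_gt0 hN hcube => h h_gt0 hN hcube ahN hp2.
have p3_gt0 : (0 < p ^ 3)%N by rewrite expn_gt0; lia.
have N_gt1 : (1 < N)%N by rewrite hN addn1 ltnS muln_gt0 h_gt0.
have N1 : (N - 1 = h * p ^ 3)%N by rewrite hN addnK.
have caN : coprime a N.
  have : coprime (a ^ (N - 1)) N by rewrite -coprime_modl hfermat coprime_modl coprime1n.
  by rewrite coprime_pexpl //; lia.
have ah_neq1 : (a ^ h <> 1 %[mod N])%N.
  by rewrite !modn_small // => ah1; have := ltn_exp2r 1 a h_gt0; rewrite exp1n ah1 ha.
have p_tot : (p %| totient N)%N.
  (* Otherwise p^3 is coprime to the totient, and (a^h)^(p^3) = a^(N - 1) = 1 would give a^h = 1. *)
  apply/negPn/negP; rewrite -prime_coprime // => cp; apply: ah_neq1.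
  apply: (@expn_eq1_mod_coprime _ (p ^ 3)) => //; first exact: coprimeXl.
  - exact: coprimeXl.
  - by rewrite -expnM -N1.
have p'N : ~~ (p %| N)%N.
  by rewrite hN dvdn_addr ?dvdn_mull ?dvdn_exp // dvdn1; lia.
have [q q_pr /andP[/dvdnP[r NE] /dvdnP[m qE]]] := prime_dvd_totient hp p_tot p'N.
have q_gt1 := prime_gt1 q_pr.
have {}qE : q = (m * p + 1)%N by rewrite -qE addn1 prednK ?prime_gt0.
have r_gt0 : (0 < r)%N by case: (posnP r) NE N_gt1 => // -> ->.
(* Modulo p both N and q are 1, hence so is the cofactor r. *)
have /dvdnP[n rE] : (p %| r - 1)%N.
  have : (p %| r * q - 1)%N by rewrite -NE N1 dvdn_mull ?dvdn_exp.
  by rewrite qE mulnDr muln1 mulnA -addnBA // dvdn_addr // dvdn_mull.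
have {}rE : r = (n * p + 1)%N by rewrite -rE subnK.
(* If n = 0 then r = 1 and N is the prime q. *)
have [n0|n_gt0] := posnP n; first by rewrite NE rE n0 mul1n.
have m_gt0 : (0 < m)%N by case: (posnP m) q_gt1 => // m0; rewrite qE m0.
exfalso; have E : (h * p ^ 3 + 1 = (n * p + 1) * (m * p + 1))%N by rewrite -hN NE rE qE.
have [mn|/ltnW nm] := leqP m n.
  exact: modn1_factorization E.
by rewrite [RHS]mulnC in E; apply: modn1_factorization E.
Qed.
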